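(* Let $\mathcal{N}$ be a set with $n\in\mathbb{N}$ distinct elements and let $k\in\{1,\ldots,n\}$. For each $\ell\in\{1,\ldots,2^k-2\}$, it holds \[ \{\mathscr{A}\in C(\mathcal{N},k)\mid (x_t(\mathscr{A}))_{t\in\mathbb{T}(k)}\in F(k,\ell)\}\cong\tilde{S}(\mathcal{N},\ell) \times F(k,\ell). \] In particular, \[ C(\mathcal{N},k)\cong\bigcup_{\ell=1}^{2^k-2}\tilde{S}(\mathcal{N},\ell) \times F(k,\ell). \]
   Context: $\mathbb{N}=\{1,2,\ldots\}$. For two sets $E_1,E_2$, write $E_1\cong E_2$ if there is a bijection $E_1\to E_2$. Constructive covers. A finite sequence $\mathscr{A}=(A_1,\ldots,A_k)$ of distinct subsets of $\mathcal{N}$ is a constructive ordered $k$-cover of $\mathcal{N}$ if (i) $\bigcup_{i=1}^k A_i=\mathcal{N}$ and (ii) $A_i\setminus A_j\neq\emptyset$ for every $i,j\in\{1,\ldots,k\}$ with $i\neq j$. $C(\mathcal{N},k)$ is the set of all constructive ordered $k$-covers of $\mathcal{N}$. Regions. Let $e,c$ be two distinct symbols, $\mathbf{e}=(e,\ldots,e)$, $\mathbf{c}=(c,\ldots,c)$, and $\mathbb{T}(k)=\{e,c\}^k\setminus\{\mathbf{e},\mathbf{c}\}$. For $\mathscr{A}=(A_1,\ldots,A_k)\in C(\mathcal{N},k)$ and $t\in\{e,c\}^k$, let $B_t(\mathscr{A})=\left(\bigcap_{i\colon t_i=c}A_i\right)\cap\left(\bigcap_{i\colon t_i=e}(\mathcal{N}\setminus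 A_i)\right)$. For $t\in\mathbb{T}(k)$, let $x_t(\mathscr{A})=1$ if $B_t(\mathscr{A})\neq\emptyset$ and $x_t(\mathscr{A})=0$ otherwise. Labelings. $G(k)$ is the set of all $(x_t)_{t\in\mathbb{T}(k)}$ with $x_t\in\{0,1\}$ for all $t\in\mathbb{T}(k)$ and $\sum_{t\in\mathbb{T}(k)\colon t_i=c,\,t_j=e}x_t\geq 1$ for all $i,j\in\{1,\ldots,k\}$ with $i\neq j$. For $\ell\in\{1,\ldots,2^k-2\}$, $F(k,\ell)=\{(x_t)_{t\in\mathbb{T}(k)}\in G(k)\mid \sum_{t\in\mathbb{T}(k)}x_t=\ell\}$. Ordered partitions. For a finite set $\mathcal{I}$ and $\ell\in\mathbb{N}$, an ordered $\ell$-partition of $\mathcal{I}$ is a sequence $(B_1,\ldots,B_\ell)$ of pairwise disjoint nonempty subsets of $\mathcal{I}$ with $B_1\cup\ldots\cup B_\ell=\mathcal{I}$; $S(\mathcal{I},\ell)$ is the set of all of them. $\tilde{S}(\mathcal{N},\ell)$ is the set of all ordered $\ell$-partitions of all subsets of $\mathcal{N}$ of size at least $\ell$, i.e. $\tilde{S}(\mathcal{N},\ell)=\bigcup\{S(\mathcal{I},\ell)\mid \mathcal{I}\subseteq\mathcal{N},\ |\mathcal{I}|\geq\ell\}$. The union over $\ell$ in the claim is a disjoint union.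
   Formalization: The ''in particular'' bijection is stated only for k at least 2: for k = 1 it fails, since C(N,1) consists of the single cover (N) while the union over ℓ from 1 to 2^1-2 = 0 is empty. *)

(* Defs.v *)
From mathcomp Require Import all_boot.

Set Implicit Arguments.
Unset Strict Implicit.
Unset Printing Implicit Defensive.

(* Existence of a bijection; [bijective] asks for a two-sided inverse. *)
Definition equinumerous (T U : Type) : Prop := exists f : T -> U, bijective f.

Notation "T ≅ U" := (equinumerous T U) (at level 70, no associativity).

(* The ground set is a finite type [N]; indices run over ['I_k], so they are
   0-based. *)
Definition constructive_covers (N : finType) (k : nat) :
    {set k.-tuple {set N}} :=
  [set A : k.-tuple {set N} |
    [&& uniq A,
        \bigcup_(i < k) tnth A i == [set: N] &
        [forall i : 'I_k, forall j : 'I_k,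
          (i != j) ==> (tnth A i :\: tnth A j != set0)]]].

(* The two symbols "e" (excluded) and "c" (contained). *)
Notation symbol := bool (only parsing).
Notation sym_e := false (only parsing).
Notation sym_c := true (only parsing).

Definition region_index (k : nat) : finType :=
  {t : k.-tuple symbol |
    (t != [tuple of nseq k sym_e]) && (t != [tuple of nseq k sym_c])}.

Definition region (N : finType) (k : nat) (A : k.-tuple {set N})
    (t : k.-tuple symbol) : {set N} :=
  (\bigcap_(i < k | tnth t i == sym_c) tnth A i)
    :&: (\bigcap_(i < k | tnth t i == sym_e) ~: tnth A i).

(* 0/1-valued families, with [true] standing for 1 (as in the coercion of
   [bool] to [nat], used in the sums below). *)
Definition labeling (k : nat) : finType := {ffun region_index k -> bool}.

Definition labeling_of (N : finType) (k : nat) (A : k.-tuple {set N}) :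
    labeling k :=
  [ffun t : region_index k => region A (val t) != set0].

Definition labelings_G (k : nat) : {set labeling k} :=
  [set x : labeling k |
    [forall i : 'I_k, forall j : 'I_k, (i != j) ==>
      (1 <= \sum_(t : region_index k |
               (tnth (val t) i == sym_c) && (tnth (val t) j == sym_e)) x t)]].

Definition labelings_F (k l : nat) : {set labeling k} :=
  [set x in labelings_G k | \sum_(t : region_index k) x t == l].

Definition ordered_partitions (N : finType) (I : {set N}) (l : nat) :
    {set l.-tuple {set N}} :=
  [set B : l.-tuple {set N} |
    [&& [forall i : 'I_l, forall j : 'I_l,
          (i != j) ==> [disjoint tnth B i & tnth B j]],
        [forall i : 'I_l, tnth B i != set0] &
        \bigcup_(i < l) tnth B i == I]].

Definition ordered_subpartitions (N : finType) (l : nat) :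
    {set l.-tuple {set N}} :=
  \bigcup_(I : {set N} | l <= #|I|) ordered_partitions I l.

(* Main.v *)
Require Import Defs.
From mathcomp Require Import all_boot.

Set Implicit Arguments.
Unset Strict Implicit.
Unset Printing Implicit Defensive.

(* Send each point [a] to its trace, the word recording which members of the
   cover contain [a]. The region of [t] is the fibre of the trace over [t], so
   a cover is the same thing as its trace map, whose fibres form a partition.
   The word ee...e is excluded by the covering condition and the fibre over
   cc...c is the complement of the others; what remains is the set of words in
   [region_index k] that occur (the labeling) and, listing these in a fixed
   order, the ordered partition formed by their fibres. *)

(** * Bijections between subtypes and dependent sums *)

Lemma equinumerous_sig (T U : Type) (P : pred T) (Q : pred U)
    (f : T -> U) (g : U -> T) :
  (forall x, P x -> Q (f x)) -> (forall y, Q y -> P (g y)) ->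
  (forall x, P x -> g (f x) = x) -> (forall y, Q y -> f (g y) = y) ->
  {x : T | P x} ≅ {y : U | Q y}.
Proof.
move=> fP gQ fK gK.
exists (fun u => exist _ (f (val u)) (fP _ (valP u))).
exists (fun v => exist _ (g (val v)) (gQ _ (valP v))).
- by move=> u; apply: val_inj; apply: fK (valP u).
- by move=> v; apply: val_inj; apply: gK (valP v).
Qed.

Lemma equinumerous_sigT (T I : Type) (U : I -> Type) (P : pred T) (R : pred I)
    (Q : forall i, pred (U i)) (h : T -> I)
    (f : forall i, T -> U i) (g : forall i, U i -> T) :
  (forall x, P x -> R (h x)) ->
  (forall x, P x -> Q (h x) (f (h x) x)) ->
  (forall i y, R i -> Q i y -> P (g i y)) ->
  (forall i y, R i -> Q i y -> h (g i y) = i) ->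
  (forall x, P x -> g (h x) (f (h x) x) = x) ->
  (forall i y, R i -> Q i y -> f i (g i y) = y) ->
  {x : T | P x} ≅ {i : {i : I | R i} & {y : U (sval i) | Q (sval i) y}}.
Proof.
move=> hR fQ gP hg fK gK.
pose F (u : {x : T | P x}) : {i : {i : I | R i} & {y | Q (sval i) y}} :=
  existT (fun i : {i : I | R i} => {y : U (sval i) | Q (sval i) y})
    (exist _ (h (sval u)) (hR _ (svalP u))) (exist (fun y => Q (h (sval u)) y) _ (fQ _ (svalP u))).
pose G (v : {i : {i : I | R i} & {y | Q (sval i) y}}) : {x : T | P x} :=
  exist _ (g _ (sval (projT2 v)))
    (gP _ _ (svalP (projT1 v)) (svalP (projT2 v))).
exists F; exists G.
- by move=> [x Px]; apply: val_inj; apply: fK.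
(* With [u], [i], [y] general, the index [i] can be substituted by [h x]; only equalities between
   boolean proofs remain. *)
- have F_eq u i y : h (sval u) = sval i -> f (sval i) (sval u) = sval y ->
    F u = existT _ i y.
    case: u i y => [x Px] [i Ri] /= [y Qy] /= hx; subst i => fx; subst y.
    rewrite /F /=.
    rewrite (eq_irrelevance (hR x _) Ri).
    by rewrite (eq_irrelevance (fQ x _) Qy).
  by move=> [[i Ri] [y Qy]]; apply: F_eq; [apply: hg | apply: gK].
Qed.

(** * Traces of points, and covers in terms of traces *)

Definition trace (N : finType) (k : nat) (A : k.-tuple {set N}) (a : N) :
    k.-tuple bool :=
  [tuple a \in tnth A i | i < k].

Lemma in_region (N : finType) (k : nat) (A : k.-tuple {set N}) t a :
  (a \in region A t) = (trace A a == t).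
Proof.
apply/idP/eqP => [|<-].
- rewrite inE => /andP[/bigcapP inA /bigcapP outA].
  apply: eq_from_tnth => i; rewrite tnth_mktuple.
  case t_i: (tnth t i); first by apply: inA; rewrite t_i.
  by apply/negbTE; rewrite -in_setC; apply: outA; rewrite t_i.
- rewrite inE; apply/andP; split; apply/bigcapP => i;
    by rewrite tnth_mktuple ?inE; case: (a \in _).
Qed.

Lemma labeling_ofP (N : finType) (k : nat) (A : k.-tuple {set N})
    (t : region_index k) :
  reflect (exists a, trace A a = val t) (labeling_of A t).
Proof.
rewrite ffunE; apply: (iffP (set0Pn _)) => [] [a].
- by rewrite in_region => /eqP; exists a.
- by move=> ta; exists a; rewrite in_region ta.
Qed.

Lemma labelings_GP (k : nat) (x : labeling k) :
  reflect (forall i j, i != j ->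
             exists t, [/\ x t, tnth (val t) i & ~~ tnth (val t) j])
          (x \in labelings_G k).
Proof.
rewrite inE; apply: (iffP forallP) => xG i.
- move=> j nij; have /forallP/(_ j) := xG i; rewrite nij /= lt0n sum_nat_eq0.
  case/forallPn => t; rewrite negb_imply eqb_id eqbF_neg eqb0 negbK.
  by case/andP=> /andP[ti tj] xt; exists t.
- apply/forallP => j; apply/implyP => /xG[t [xt ti tj]].
  by rewrite (bigD1 t) ?ti ?(negbTE tj) //= xt.
Qed.

Lemma constructive_coversE (N : finType) (k : nat) (A : k.-tuple {set N}) :
  (A \in constructive_covers N k) =
    [forall a, trace A a != [tuple of nseq k false]]
      && (labeling_of A \in labelings_G k).
Proof.
have diffP : reflect
    (forall i j : 'I_k, i != j -> tnth A i :\: tnth A j != set0)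
    (labeling_of A \in labelings_G k).
  apply: (iffP (labelings_GP _)) => AG i j /AG.
  - case=> t [/labeling_ofP[a ta] ti tj]; apply/set0Pn; exists a.
    by move: ti tj; rewrite -ta !tnth_mktuple inE => -> ->.
  - case/set0Pn => a; rewrite inE => /andP[aj ai].
    (* The trace is c at [i] and e at [j], so it is neither of the two constant words and is a
       legitimate region index. *)
    have ta : (trace A a != [tuple of nseq k false])
                && (trace A a != [tuple of nseq k true]).
      apply/andP; split; apply/eqP.
      + by move=> /(congr1 (fun t => tnth t i));
          rewrite tnth_mktuple tnth_nseq ai.
      + by move=> /(congr1 (fun t => tnth t j));
          rewrite tnth_mktuple tnth_nseq (negbTE aj).
    exists (exist _ (trace A a) ta); rewrite /= !tnth_mktuple; split=> //.
    by apply/labeling_ofP; exists a.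
have coverE : (\bigcup_(i < k) tnth A i == [set: N]) =
    [forall a, trace A a != [tuple of nseq k false]].
  apply/eqP/forallP => [cA a | cA].
  - have := in_setT a; rewrite -cA => /bigcupP[i _ ai].
    apply/eqP => /(congr1 (fun t => tnth t i)).
    by rewrite tnth_mktuple tnth_nseq ai.
  - apply/setP => a; rewrite inE; apply/bigcupP.
    case: (pickP (fun i => a \in tnth A i)) => [i ai | aN]; first by exists i.
    case/eqP: (cA a); apply: eq_from_tnth => i.
    by rewrite tnth_mktuple tnth_nseq aN.
rewrite inE coverE andbCA; congr (_ && _).
apply/andP/diffP => [[_ /forallP dA] i j nij | dA].
- by have /forallP/(_ j)/implyP := dA i; apply.
- split; last first.
    by apply/forallP => i; apply/forallP => j; apply/implyP; apply: dA.
  (* Equal members at different positions would have an empty difference. *)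
  apply/tuple_uniqP => i j Aij; apply/eqP; apply: contraT => /dA.
  by rewrite Aij setDv eqxx.
Qed.

Lemma ordered_subpartitionsP (N : finType) (l : nat) (B : l.-tuple {set N}) :
  reflect ((forall i j a, a \in tnth B i -> a \in tnth B j -> i = j)
             /\ (forall i, exists a, a \in tnth B i))
          (B \in ordered_subpartitions N l).
Proof.
apply: (iffP bigcupP) => [[I _] | [disjB neB]].
- rewrite inE => /and3P[/forallP disjB /forallP neB _].
  split=> [i j a ai aj | i]; last exact/set0Pn.
  apply/eqP; apply: contraT => nij.
  have /forallP/(_ j) := disjB i; rewrite nij => /pred0P/(_ a).
  by rewrite /= ai aj.
- exists (\bigcup_(i < l) tnth B i).
    (* One point chosen in each block gives [l] distinct points of the union, by disjointness; this
       yields the bound on its size. *)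
    pose r i := xchoose (neB i).
    have rB i : r i \in tnth B i by apply: xchooseP.
    have r_inj : injective r.
      by move=> i j rij; apply: (disjB _ _ (r i)) => //; rewrite rij.
    rewrite -[leqLHS]card_ord -(card_imset _ r_inj); apply: subset_leq_card.
    by apply/subsetP => _ /imsetP[i _ ->]; apply/bigcupP; exists i.
  rewrite inE eqxx andbT; apply/andP; split; apply/forallP => i.
  + apply/forallP => j; apply/implyP => nij; apply/pred0P => a /=.
    apply/negP => /andP[ai aj]; case/eqP: nij; exact: disjB ai aj.
  + exact/set0Pn.
Qed.

(** * A fixed enumeration of the words occurring in a labeling *)

(** The entries are plain words because [region_index k] can be empty (for [k = 1]) and would then
    provide no default for [nth]. *)
Definition patterns (k : nat) (x : labeling k) : seq (k.-tuple bool) :=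
  [seq val t | t <- enum [pred t | x t]].

(* Indices past the size give the junk value ee...e. *)
Definition pattern (k : nat) (x : labeling k) (j : nat) : k.-tuple bool :=
  nth [tuple of nseq k false] (patterns x) j.

Lemma size_patterns (k : nat) (x : labeling k) :
  size (patterns x) = \sum_(t : region_index k) x t.
Proof.
rewrite size_map -cardE -sum1_card big_mkcond /=.
by apply: eq_bigr => t _; rewrite unfold_in; case: (x t).
Qed.

Lemma patterns_uniq (k : nat) (x : labeling k) : uniq (patterns x).
Proof. by rewrite (map_inj_uniq val_inj) enum_uniq. Qed.

Lemma mem_patterns (k : nat) (x : labeling k) (t : region_index k) :
  (val t \in patterns x) = x t.
Proof. by rewrite (mem_map val_inj) mem_enum. Qed.

(** * The two mutually inverse maps for a fixed number of blocks *)

Section FixedLength.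

Variables (N : finType) (k l : nat).
Implicit Types (x : labeling k) (A : k.-tuple {set N}) (B : l.-tuple {set N}).

Definition regions_of A : l.-tuple {set N} * labeling k :=
  ([tuple region A (pattern (labeling_of A) j) | j < l], labeling_of A).

(* A point lying in no block is put in every member of the cover. *)
Definition cover_of (p : l.-tuple {set N} * labeling k) : k.-tuple {set N} :=
  [tuple [set a | [forall j : 'I_l,
                    (a \in tnth p.1 j) ==> tnth (pattern p.2 j) i]] | i < k].

Lemma labelings_FP x :
  reflect (x \in labelings_G k /\ size (patterns x) = l)
          (x \in labelings_F k l).
Proof.
by rewrite [x \in labelings_F k l]inE size_patterns; apply: (iffP andP) => [] [-> /eqP].
Qed.

Section PatternIndex.

Variables (x : labeling k).
Hypothesis size_x : size (patterns x) = l.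

Lemma pattern_valP (j : 'I_l) : exists2 t, x t & pattern x j = val t.
Proof.
have: pattern x j \in patterns x by rewrite mem_nth ?size_x.
by case/mapP=> t; rewrite mem_enum => xt ->; exists t.
Qed.

Lemma pattern_inj (j1 j2 : 'I_l) : pattern x j1 = pattern x j2 -> j1 = j2.
Proof.
move/eqP; rewrite nth_uniq ?size_x ?patterns_uniq // => /eqP.
exact: val_inj.
Qed.

Lemma pattern_onto (t : region_index k) :
  x t -> exists j : 'I_l, pattern x j = val t.
Proof.
rewrite -mem_patterns => tx; have := tx; rewrite -index_mem size_x => lt_tl.
by exists (Ordinal lt_tl); apply: nth_index.
Qed.

End PatternIndex.

(** Blocks are disjoint because different indices carry different words, and nonempty because each
    listed word is the trace of some point. *)
Lemma regions_of_subpartition A :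
  labeling_of A \in labelings_F k l ->
  regions_of A \in setX (ordered_subpartitions N l) (labelings_F k l).
Proof.
move=> AF; rewrite inE /= AF andbT.
have [_ size_A] := labelings_FP _ AF.
apply/ordered_subpartitionsP; split=> [i j a | j]; rewrite !tnth_mktuple.
- rewrite !in_region => /eqP-> /eqP; exact: pattern_inj.
- have [t /labeling_ofP[a ta] ->] := pattern_valP size_A j.
  by exists a; rewrite in_region ta.
Qed.

(** A trace other than ee...e is either cc...c, and then the point lies in every member of [A], or a
    listed word, and then its block imposes exactly the memberships spelled by that word. *)
Lemma regions_ofK A :
  (forall a, trace A a != [tuple of nseq k false]) ->
  labeling_of A \in labelings_F k l -> cover_of (regions_of A) = A.
Proof.
move=> covA /labelings_FP[_ size_A].
apply: eq_from_tnth => i; apply/setP => a; rewrite tnth_mktuple inE /=.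
have <- : tnth (trace A a) i = (a \in tnth A i) by rewrite tnth_mktuple.
apply/forallP/idP => [aA | ai j]; last first.
  by rewrite tnth_mktuple in_region; apply/implyP => /eqP<-.
have [->|neqc] := eqVneq (trace A a) [tuple of nseq k true].
  by rewrite tnth_nseq.
have ta : (trace A a != [tuple of nseq k false])
            && (trace A a != [tuple of nseq k true]) by rewrite covA.
have [|j jt] := pattern_onto size_A (t := exist _ (trace A a) ta).
  by apply/labeling_ofP; exists a.
have := aA j; rewrite tnth_mktuple in_region jt /= => /implyP; exact.
Qed.

Section CoverOf.

Variables (B : l.-tuple {set N}) (x : labeling k).
Hypothesis BP : B \in ordered_subpartitions N l.
Hypothesis xF : x \in labelings_F k l.

Let size_x : size (patterns x) = l.
Proof. by case/labelings_FP: xF. Qed.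

(** By disjointness, block [j] gives the only nonvacuous condition on [a] in [cover_of]. *)
Lemma trace_cover_of_block j a :
  a \in tnth B j -> trace (cover_of (B, x)) a = pattern x j.
Proof.
have [disjB _] := ordered_subpartitionsP _ BP.
move=> aj; apply: eq_from_tnth => i; rewrite !tnth_mktuple inE /=.
apply/forallP/idP => [/(_ j) | xi j']; first by rewrite aj.
by apply/implyP => aj'; rewrite (disjB _ _ _ aj' aj).
Qed.

Lemma trace_cover_of_out a :
  (forall j, a \notin tnth B j) ->
  trace (cover_of (B, x)) a = [tuple of nseq k true].
Proof.
move=> aN; apply: eq_from_tnth => i; rewrite !tnth_mktuple inE tnth_nseq /=.
by apply/forallP => j; rewrite (negbTE (aN j)).
Qed.

Lemma trace_cover_ofP a :
  (exists2 j, a \in tnth B j & trace (cover_of (B, x)) a = pattern x j)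
  \/ trace (cover_of (B, x)) a = [tuple of nseq k true].
Proof.
case: (pickP (fun j => a \in tnth B j)) => [j aj | aN].
- by left; exists j => //; apply: trace_cover_of_block.
- by right; apply: trace_cover_of_out => j; rewrite aN.
Qed.

(** Nonempty blocks realize every listed word; points outside the blocks have trace cc...c, which is
    not a region index. *)
Lemma labeling_cover_of : labeling_of (cover_of (B, x)) = x.
Proof.
apply/ffunP => t; apply/labeling_ofP/idP => [[a ta] | xt].
- have [[j _] | tc] := trace_cover_ofP a.
    have [s xs ->] := pattern_valP size_x j.
    by rewrite ta => /val_inj->.
  by have := valP t; rewrite /= -ta tc eqxx andbF.
- have [j <-] := pattern_onto size_x xt.
  have [_ /(_ j)[a aj]] := ordered_subpartitionsP _ BP.
  by exists a; apply: trace_cover_of_block.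
Qed.

(** The fibre over the [j]-th word is block [j]: other blocks carry other words, and leftover points
    carry cc...c, which is never listed. *)
Lemma cover_ofK : regions_of (cover_of (B, x)) = (B, x).
Proof.
rewrite /regions_of labeling_cover_of; congr (_, _).
apply: eq_from_tnth => j; apply/setP => a.
rewrite tnth_mktuple in_region; apply/eqP/idP; last first.
  exact: trace_cover_of_block.
have [[j' aj' ->] | ->] := trace_cover_ofP a.
  by move/(pattern_inj size_x) => <-.
have [t _ ->] := pattern_valP size_x j => tc.
by have := valP t; rewrite /= -tc eqxx andbF.
Qed.

Lemma cover_of_covers : 0 < k -> cover_of (B, x) \in constructive_covers N k.
Proof.
move=> k_gt0; rewrite constructive_coversE labeling_cover_of.
have [-> _] := labelings_FP _ xF; rewrite andbT; apply/forallP => a.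
have [[j _ ->] | ->] := trace_cover_ofP a.
  have [t _ ->] := pattern_valP size_x j.
  by have /andP[] := valP t.
(* For a leftover point, cc...c and ee...e are told apart at coordinate 0, which exists because [k]
   is positive. *)
apply/eqP => /(congr1 (fun t => tnth t (Ordinal k_gt0))).
by rewrite !tnth_nseq.
Qed.

End CoverOf.

End FixedLength.

(** * Range of the number of blocks, and the bijections *)

Lemma card_region_index (k : nat) : 0 < k -> #|region_index k| = 2 ^ k - 2.
Proof.
move=> k_gt0; rewrite card_sig.
have neq_ec : [tuple of nseq k false] != [tuple of nseq k true].
  by case: k k_gt0.
have := cardsC [set [tuple of nseq k false]; [tuple of nseq k true]].
rewrite cards2 neq_ec card_tuple card_bool => <-.
by rewrite addKn; apply: eq_card => t; rewrite !inE negb_or.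
Qed.

Lemma labelings_G_sum (k : nat) (x : labeling k) :
  1 < k -> x \in labelings_G k ->
  1 <= \sum_(t : region_index k) x t <= 2 ^ k - 2.
Proof.
move=> k_gt1 /labelings_GP xG; apply/andP; split.
  (* The two distinct indices 0 and 1, available since [1 < k], force some word to be labeled 1. *)
  have [//|t [xt _ _]] := xG (Ordinal (ltnW k_gt1)) (Ordinal k_gt1).
  by rewrite (bigD1 t) //= xt.
rewrite -card_region_index; last exact: ltnW.
by rewrite -size_patterns size_map -cardE max_card.
Qed.

(* The hypothesis [1 < k] in the second part is needed: for k = 1 there is
   exactly one cover, while the union on the right is empty. *)
Theorem theorem3p5 (N : finType) (n k : nat) (n_gt0 : 0 < n)
    (cardN : #|N| = n) (k_bounds : 1 <= k <= n) :
  (forall l : nat, 1 <= l <= 2 ^ k - 2 ->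
     {A : k.-tuple {set N} |
        (A \in constructive_covers N k) && (labeling_of A \in labelings_F k l)}
     ≅ {p : l.-tuple {set N} * labeling k |
          p \in setX (ordered_subpartitions N l) (labelings_F k l)})
  /\
  (1 < k ->
     {A : k.-tuple {set N} | A \in constructive_covers N k}
     ≅ {l : {l : nat | 1 <= l <= 2 ^ k - 2} &
          {p : (sval l).-tuple {set N} * labeling k |
             p \in setX (ordered_subpartitions N (sval l))
                        (labelings_F k (sval l))}}).
Proof.
have [k_gt0 _] := andP k_bounds.
split=> [l _ | k_gt1].
- apply: (equinumerous_sig (f := @regions_of N k l) (g := @cover_of N k l)).
  + by move=> A /andP[_]; apply: regions_of_subpartition.
  + move=> [B x]; rewrite inE /= => /andP[BP xF].
    by rewrite cover_of_covers // labeling_cover_of.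
  + move=> A /andP[]; rewrite constructive_coversE => /andP[/forallP cA _].
    exact: regions_ofK.
  + by move=> [B x]; rewrite inE /= => /andP[BP xF]; apply: cover_ofK.
- have coverF A : A \in constructive_covers N k ->
      labeling_of A \in labelings_F k (\sum_t labeling_of A t).
    by rewrite constructive_coversE => /andP[_ AG]; rewrite inE AG eqxx.
  (* A cover goes to the component indexed by the number of ones in its labeling, where the
     fixed-length maps apply. *)
  apply: (equinumerous_sigT
    (U := fun l => (l.-tuple {set N} * labeling k)%type)
    (Q := fun l p => p \in setX (ordered_subpartitions N l) (labelings_F k l))
    (h := fun A => \sum_t labeling_of A t)
    (f := @regions_of N k) (g := @cover_of N k)).
  + move=> A; rewrite constructive_coversE => /andP[_ AG].
    exact: labelings_G_sum.
  + by move=> A /coverF; apply: regions_of_subpartition.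
  + move=> l [B x] _; rewrite inE /= => /andP[BP xF].
    exact: cover_of_covers.
  + move=> l [B x] _; rewrite inE /= => /andP[BP xF].
    by rewrite labeling_cover_of //; move: xF; rewrite inE => /andP[_ /eqP].
  + move=> A cA; apply: regions_ofK (coverF _ cA).
    by apply/forallP; move: cA; rewrite constructive_coversE => /andP[].
  + by move=> l [B x] _; rewrite inE /= => /andP[BP xF]; apply: cover_ofK.
Qed.
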